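(* For all types $X,R$, Spector's bar recursor $\mathsf{BR}_{X,R}$ is primitive recursively definable from the symmetric bar recursor $\mathsf{sBR}_{X\times\mathbb{B},R}$, provably in $\mathsf{E\text{-}HA}^\omega+\mathsf{sBR}$: there is a term $\Delta$ of Gödel's system $\mathsf{T}$ extended by the constant $\mathsf{sBR}_{X\times\mathbb{B},R}$ such that $\mathsf{E\text{-}HA}^\omega+\mathsf{sBR}$ proves that, for all $\phi\colon X^*\to(X\to R)\to R$, $b\colon X^*\to R$, $\varphi\colon X^{\mathbb{N}}\to\mathbb{N}$ and $s\colon X^*$, $$\Delta^{\phi,b,\varphi}(s)=\begin{cases}b(s)&\text{if }\varphi(\hat s)<|s|,\\ \phi(s)\big(\lambda x^X.\,\Delta^{\phi,b,\varphi}(s*\langle x\rangle)\big)&\text{otherwise.}\end{cases}$$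
   Context: $\mathsf{E\text{-}HA}^\omega$ is extensional Heyting arithmetic in all finite types (full induction, $\lambda$-abstraction, primitive recursors at all types; quantifier-free fragment Gödel's system $\mathsf{T}$). $\mathbb{B}=\{0,1\}$. $X^*$ is the type of finite sequences over $X$, $|s|$ the length, $s*\langle x\rangle$ the extension by $x$; $\hat s\colon X^{\mathbb{N}}$ extends $s$ by the canonical element $\mathbf{0}_X$. $Z^\dagger$ is the type of finite partial functions from $\mathbb{N}$ to $Z$ with decidable finite domain $\mathrm{dom}(u)$; $\hat u\colon Z^{\mathbb{N}}$ agrees with $u$ on $\mathrm{dom}(u)$ and is $\mathbf{0}_Z$ elsewhere; $u\oplus(n,x)$ equals $u$ if $n\in\mathrm{dom}(u)$ and otherwise is $u$ extended with value $x$ at $n$. $\mathsf{E\text{-}HA}^\omega+\mathsf{sBR}$ adds constants $\mathsf{sBR}_{Z,R}$ with defining equations: for $\phi\colon Z^\dagger\to(Z\to R)\to R$, $b\colon Z^\dagger\to R$, $\varphi\colon Z^{\mathbb{N}}\to\mathbb{N}$, $u\colon Z^\dagger$: $\mathsf{sBR}^{\phi,b,\varphi}(u)=b(u)$ if $\varphi(\hat u)\in\mathrm{dom}(u)$, and $=\phi(u)(\lambda z.\mathsf{sBR}^{\phi,b,\varphi}(u\oplus(\varphi(\hat u),z)))$ otherwise. The displayed equation is the defining equation of Spector's bar recursor $\mathsf{BR}_{X,R}$. *)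

(* Defs.v *)
From Stdlib Require Import List.
Import ListNotations.

Set Implicit Arguments.

(** A deep embedding of E-HA^omega + sBR: finite types, intrinsically typed
    de Bruijn terms, many-sorted first-order formulas, and intuitionistic
    natural deduction. *)

Inductive ty : Type :=
| TN : ty
| TB : ty
| TArr : ty -> ty -> ty
| TProd : ty -> ty -> ty
| TSeq : ty -> ty
| TPfn : ty -> ty.

Declare Scope ty_scope.
Delimit Scope ty_scope with ty.
Bind Scope ty_scope with ty.
Notation "A ⇒ B" := (TArr A B) (at level 55, right associativity) : ty_scope.
Notation "A ⊗ B" := (TProd A B) (at level 45, left associativity) : ty_scope.
Notation "X ^*" := (TSeq X) (at level 2, left associativity, format "X ^*") : ty_scope.
Notation "Z ^†" := (TPfn Z) (at level 2, left associativity, format "Z ^†") : ty_scope.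
Open Scope ty_scope.

Definition ctx := list ty.

Inductive var : ctx -> ty -> Type :=
| vz : forall G A, var (A :: G) A
| vs : forall G A B, var G A -> var (B :: G) A.
Arguments vz {G A}.
Arguments vs {G A B} _.

(** Sequences are generated by [CNil] and right extension [CSnoc], with
    recursor [CSeqRec].  A finite partial function [u] is given by its decidable
    domain [CDom], its total extension [CHat], the operation u ⊕ (n,x) [CExt],
    and [CBnd u], the least strict upper bound of dom(u), which makes the
    finiteness of the domain available to terms.  Partial functions have no
    recursor of their own: recursion over them is recursion up to [CBnd]. *)
Inductive cst : ty -> Type :=
| CZero : cst TN
| CSucc : cst (TN ⇒ TN)
| CRec : forall A, cst (A ⇒ (TN ⇒ A ⇒ A) ⇒ TN ⇒ A)
| CFalse : cst TB
| CTrue : cst TB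
| CIf : forall A, cst (TB ⇒ A ⇒ A ⇒ A)
| CPair : forall A B, cst (A ⇒ B ⇒ A ⊗ B)
| CFst : forall A B, cst (A ⊗ B ⇒ A)
| CSnd : forall A B, cst (A ⊗ B ⇒ B)
| CNil : forall X, cst X^*
| CSnoc : forall X, cst (X^* ⇒ X ⇒ X^*)
| CSeqRec : forall X A, cst (A ⇒ (X^* ⇒ X ⇒ A ⇒ A) ⇒ X^* ⇒ A)
| CEmp : forall Z, cst Z^†
| CExt : forall Z, cst (Z^† ⇒ TN ⇒ Z ⇒ Z^†)
| CDom : forall Z, cst (Z^† ⇒ TN ⇒ TB)
| CHat : forall Z, cst (Z^† ⇒ TN ⇒ Z)
| CBnd : forall Z, cst (Z^† ⇒ TN)
| CsBR : forall Z R,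
    cst ((Z^† ⇒ (Z ⇒ R) ⇒ R) ⇒ (Z^† ⇒ R) ⇒ ((TN ⇒ Z) ⇒ TN) ⇒ Z^† ⇒ R).

Inductive tm (G : ctx) : ty -> Type :=
| Var : forall A, var G A -> tm G A
| Cst : forall A, cst A -> tm G A
| App : forall A B, tm G (A ⇒ B) -> tm G A -> tm G B
| Lam : forall A B, tm (A :: G) B -> tm G (A ⇒ B).
Arguments Cst {G A} _.

Declare Scope tm_scope.
Delimit Scope tm_scope with tm.
Bind Scope tm_scope with tm.
Notation "t · u" := (App t u) (at level 40, left associativity) : tm_scope.
Open Scope tm_scope.

(** [uses_only_sBR Z R t]: [t] is a term of System T extended by the single
    constant sBR_{Z,R}. *)
Definition cst_ok (Z R : ty) {A} (c : cst A) : Prop :=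
  match c with
  | CsBR Z' R' => Z' = Z /\ R' = R
  | _ => True
  end.

Fixpoint uses_only_sBR (Z R : ty) {G A} (t : tm G A) : Prop :=
  match t with
  | Var _ => True
  | Cst c => cst_ok Z R c
  | App t u => uses_only_sBR Z R t /\ uses_only_sBR Z R u
  | Lam t => uses_only_sBR Z R t
  end.

Definition ren (G D : ctx) := forall A, var G A -> var D A.
Definition sub (G D : ctx) := forall A, var G A -> tm D A.

Definition up_ren {G D} {C : ty} (r : ren G D) : ren (C :: G) (C :: D) :=
  fun A v =>
    match v in var G' A'
      return match G' with
             | nil => unit
             | C' :: G0 => ren G0 D -> var (C' :: D) A'
             end
    with
    | vz => fun _ => vz
    | vs w => fun r => vs (r _ w)
    end r.

Fixpoint rename {G D A} (r : ren G D) (t : tm G A) : tm D A :=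
  match t in tm _ A' return tm D A' with
  | Var v => Var (r _ v)
  | Cst c => Cst c
  | App t u => rename r t · rename r u
  | Lam t => Lam (rename (up_ren r) t)
  end.

Definition wk {G A} {C : ty} (t : tm G A) : tm (C :: G) A :=
  rename (fun _ v => vs v) t.

Definition closed {G A} (t : tm [] A) : tm G A :=
  rename (fun A (v : var [] A) =>
            match v in var G' _ return match G' with nil => var G A | _ => unit end
            with vz => tt | vs _ => tt end) t.

Definition scons {G D} {C : ty} (t : tm D C) (s : sub G D) : sub (C :: G) D :=
  fun A v =>
    match v in var G' A'
      return match G' with
             | nil => unit
             | C' :: G0 => tm D C' -> sub G0 D -> tm D A'
             end
    with
    | vz => fun t _ => t
    | vs w => fun _ s => s _ w
    end t s.

Definition up_sub {G D} {C : ty} (s : sub G D) : sub (C :: G) (C :: D) :=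
  scons (Var vz) (fun _ v => wk (s _ v)).

Fixpoint subst {G D A} (s : sub G D) (t : tm G A) : tm D A :=
  match t in tm _ A' return tm D A' with
  | Var v => s _ v
  | Cst c => Cst c
  | App t u => subst s t · subst s u
  | Lam t => Lam (subst (up_sub s) t)
  end.

Definition sub1 {G} {C : ty} (u : tm G C) : sub (C :: G) G :=
  scons u (fun _ v => Var v).

Definition v0 {G A} : tm (A :: G) A := Var vz.
Definition v1 {G A B} : tm (B :: A :: G) A := Var (vs vz).
Definition v2 {G A B C} : tm (C :: B :: A :: G) A := Var (vs (vs vz)).
Definition v3 {G A B C D} : tm (D :: C :: B :: A :: G) A :=
  Var (vs (vs (vs vz))).

Definition zeroN {G} : tm G TN := Cst CZero.
Definition succ {G} (n : tm G TN) : tm G TN := Cst CSucc · n.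
Definition natrec {G A} (a : tm G A) (f : tm G (TN ⇒ A ⇒ A)) (n : tm G TN)
  : tm G A := Cst (CRec A) · a · f · n.
Definition tfalse {G} : tm G TB := Cst CFalse.
Definition ttrue {G} : tm G TB := Cst CTrue.
Definition ite {G A} (c : tm G TB) (t u : tm G A) : tm G A :=
  Cst (CIf A) · c · t · u.
Definition tpair {G A B} (t : tm G A) (u : tm G B) : tm G (A ⊗ B) :=
  Cst (CPair A B) · t · u.
Definition tfst {G A B} (t : tm G (A ⊗ B)) : tm G A := Cst (CFst A B) · t.
Definition tsnd {G A B} (t : tm G (A ⊗ B)) : tm G B := Cst (CSnd A B) · t.
Definition tnil {G X} : tm G X^* := Cst (CNil X).
Definition snoc {G X} (s : tm G X^*) (x : tm G X) : tm G X^* :=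
  Cst (CSnoc X) · s · x.
Definition seqrec {G X A} (a : tm G A) (f : tm G (X^* ⇒ X ⇒ A ⇒ A))
  (s : tm G X^*) : tm G A := Cst (CSeqRec X A) · a · f · s.
Definition emp {G Z} : tm G Z^† := Cst (CEmp Z).
Definition ext {G Z} (u : tm G Z^†) (n : tm G TN) (x : tm G Z) : tm G Z^† :=
  Cst (CExt Z) · u · n · x.
Definition dom {G Z} (u : tm G Z^†) (n : tm G TN) : tm G TB :=
  Cst (CDom Z) · u · n.
Definition pfn_hat {G Z} (u : tm G Z^†) : tm G (TN ⇒ Z) := Cst (CHat Z) · u.
Definition bnd {G Z} (u : tm G Z^†) : tm G TN := Cst (CBnd Z) · u.

(** 0_X *)
Fixpoint canon {G} (X : ty) : tm G X :=
  match X with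
  | TN => zeroN
  | TB => tfalse
  | A ⇒ B => Lam (canon B)
  | A ⊗ B => tpair (canon A) (canon B)
  | X^* => tnil
  | Z^† => emp
  end.

Definition add {G} (m n : tm G TN) : tm G TN :=
  natrec m (Lam (Lam (succ v0))) n.
Definition pred {G} (n : tm G TN) : tm G TN :=
  natrec zeroN (Lam (Lam v1)) n.
Definition monus {G} (m n : tm G TN) : tm G TN :=
  natrec m (Lam (Lam (pred v0))) n.
Definition is_zero {G} (n : tm G TN) : tm G TB :=
  natrec ttrue (Lam (Lam tfalse)) n.
Definition eqb {G} (m n : tm G TN) : tm G TB :=
  is_zero (add (monus m n) (monus n m)).

Definition len {G X} (s : tm G X^*) : tm G TN :=
  seqrec zeroN (Lam (Lam (Lam (succ v0)))) s.

(** The recursion step is λs x f n. if n = |s| then x else f n. *)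
Definition seq_hat {G X} (s : tm G X^*) : tm G (TN ⇒ X) :=
  seqrec (Lam (canon X))
    (Lam (Lam (Lam (Lam (ite (eqb v0 (len v3)) v2 (v1 · v0)))))) s.

Inductive fm (G : ctx) : Type :=
| Bot : fm G
| Eq : forall A, tm G A -> tm G A -> fm G
| And : fm G -> fm G -> fm G
| Or : fm G -> fm G -> fm G
| Imp : fm G -> fm G -> fm G
| All : forall A, fm (A :: G) -> fm G
| Ex : forall A, fm (A :: G) -> fm G.
Arguments Bot {G}.
Arguments All {G} A _.
Arguments Ex {G} A _.

Definition Not {G} (P : fm G) : fm G := Imp P Bot.

Definition Cases {G} (P Q1 Q2 : fm G) : fm G :=
  And (Imp P Q1) (Imp (Not P) Q2).

Definition Lt {G} (m n : tm G TN) : fm G := Eq (monus (succ m) n) zeroN.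

Definition InDom {G Z} (n : tm G TN) (u : tm G Z^†) : fm G := Eq (dom u n) ttrue.

Fixpoint frename {G D} (r : ren G D) (P : fm G) : fm D :=
  match P with
  | Bot => Bot
  | Eq t u => Eq (rename r t) (rename r u)
  | And P Q => And (frename r P) (frename r Q)
  | Or P Q => Or (frename r P) (frename r Q)
  | Imp P Q => Imp (frename r P) (frename r Q)
  | All A P => All A (frename (up_ren r) P)
  | Ex A P => Ex A (frename (up_ren r) P)
  end.

Definition fwk {G} {C : ty} (P : fm G) : fm (C :: G) :=
  frename (fun _ v => vs v) P.

Fixpoint fsubst {G D} (s : sub G D) (P : fm G) : fm D :=
  match P with
  | Bot => Bot
  | Eq t u => Eq (subst s t) (subst s u)
  | And P Q => And (fsubst s P) (fsubst s Q)
  | Or P Q => Or (fsubst s P) (fsubst s Q)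
  | Imp P Q => Imp (fsubst s P) (fsubst s Q)
  | All A P => All A (fsubst (up_sub s) P)
  | Ex A P => Ex A (fsubst (up_sub s) P)
  end.

Definition finst {G} {C : ty} (P : fm (C :: G)) (u : tm G C) : fm G :=
  fsubst (sub1 u) P.

(** From [P x] to [P (t x y1 ... yk)], where [x] and the [yi] are the variables
    of the extended context. *)
Definition fstep1 {G} {C D1 : ty} (P : fm (C :: G)) (t : tm (D1 :: G) C)
  : fm (D1 :: G) := fsubst (scons t (fun _ v => Var (vs v))) P.
Definition fstep2 {G} {C D1 D2 : ty} (P : fm (C :: G))
  (t : tm (D2 :: D1 :: G) C) : fm (D2 :: D1 :: G) :=
  fsubst (scons t (fun _ v => Var (vs (vs v)))) P.

(** Axioms are schematic in the terms (and, for induction, formulas) of an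
    arbitrary context. *)
Inductive EHA_ax : forall G, fm G -> Prop :=
| ax_beta : forall G A B (t : tm (A :: G) B) (u : tm G A),
    EHA_ax (Eq (Lam t · u) (subst (sub1 u) t))
| ax_funext : forall G A B (f g : tm G (A ⇒ B)),
    EHA_ax (Imp (All A (Eq (wk f · v0) (wk g · v0))) (Eq f g))
| ax_succ_neq : forall G (n : tm G TN),
    EHA_ax (Not (Eq (succ n) zeroN))
| ax_succ_inj : forall G (m n : tm G TN),
    EHA_ax (Imp (Eq (succ m) (succ n)) (Eq m n))
| ax_rec_zero : forall G A (a : tm G A) f,
    EHA_ax (Eq (natrec a f zeroN) a)
| ax_rec_succ : forall G A (a : tm G A) f n,
    EHA_ax (Eq (natrec a f (succ n)) (f · n · natrec a f n))
| ax_ind_nat : forall G (P : fm (TN :: G)),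
    EHA_ax (Imp (finst P zeroN)
           (Imp (All TN (Imp P (fstep1 P (succ v0))))
           (All TN P)))
| ax_if_true : forall G A (a b : tm G A), EHA_ax (Eq (ite ttrue a b) a)
| ax_if_false : forall G A (a b : tm G A), EHA_ax (Eq (ite tfalse a b) b)
| ax_ind_bool : forall G (P : fm (TB :: G)),
    EHA_ax (Imp (finst P tfalse) (Imp (finst P ttrue) (All TB P)))
| ax_fst : forall G A B (a : tm G A) (b : tm G B), EHA_ax (Eq (tfst (tpair a b)) a)
| ax_snd : forall G A B (a : tm G A) (b : tm G B), EHA_ax (Eq (tsnd (tpair a b)) b)
| ax_pair : forall G A B (p : tm G (A ⊗ B)), EHA_ax (Eq (tpair (tfst p) (tsnd p)) p)
| ax_seqrec_nil : forall G X A (a : tm G A) (f : tm G (X^* ⇒ X ⇒ A ⇒ A)),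
    EHA_ax (Eq (seqrec a f tnil) a)
| ax_seqrec_snoc : forall G X A (a : tm G A) (f : tm G (X^* ⇒ X ⇒ A ⇒ A)) s x,
    EHA_ax (Eq (seqrec a f (snoc s x)) (f · s · x · seqrec a f s))
| ax_ind_seq : forall G X (P : fm (X^* :: G)),
    EHA_ax (Imp (finst P tnil)
           (Imp (All X^* (All X (Imp (fwk P) (fstep2 P (snoc v1 v0)))))
           (All X^* P)))
| ax_dom_emp : forall G Z (n : tm G TN), EHA_ax (Not (InDom n (@emp G Z)))
| ax_hat_undef : forall G Z (u : tm G Z^†) n,
    EHA_ax (Imp (Not (InDom n u)) (Eq (pfn_hat u · n) (canon Z)))
| ax_ext_old : forall G Z (u : tm G Z^†) n x,
    EHA_ax (Imp (InDom n u) (Eq (ext u n x) u))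
| ax_ext_new : forall G Z (u : tm G Z^†) n x,
    EHA_ax (Imp (Not (InDom n u))
           (And (InDom n (ext u n x)) (Eq (pfn_hat (ext u n x) · n) x)))
| ax_ext_other : forall G Z (u : tm G Z^†) n x m,
    EHA_ax (Imp (Not (Eq m n))
           (And (Eq (dom (ext u n x) m) (dom u m))
                (Eq (pfn_hat (ext u n x) · m) (pfn_hat u · m))))
| ax_bnd : forall G Z (u : tm G Z^†) n,
    EHA_ax (Imp (InDom n u) (Lt n (bnd u)))
| ax_bnd_least : forall G Z (u : tm G Z^†) n,
    EHA_ax (Imp (Eq (bnd u) (succ n)) (InDom n u))
| ax_pfn_ext : forall G Z (u v : tm G Z^†),
    EHA_ax (Imp (All TN (And (Eq (dom (wk u) v0) (dom (wk v) v0))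
                             (Eq (pfn_hat (wk u) · v0) (pfn_hat (wk v) · v0))))
           (Eq u v)).

Definition sBR_eqn {G Z R} (phi : tm G (Z^† ⇒ (Z ⇒ R) ⇒ R))
    (b : tm G (Z^† ⇒ R)) (f : tm G ((TN ⇒ Z) ⇒ TN)) (u : tm G Z^†) : fm G :=
  let rec := Cst (CsBR Z R) · phi · b · f in
  let n := f · pfn_hat u in
  Cases (InDom n u)
    (Eq (rec · u) (b · u))
    (Eq (rec · u) (phi · u · Lam (wk rec · ext (wk u) (wk n) v0))).

Inductive sBR_ax : forall G, fm G -> Prop :=
| ax_sBR : forall G Z R (phi : tm G (Z^† ⇒ (Z ⇒ R) ⇒ R)) b f u,
    sBR_ax (sBR_eqn phi b f u).

Definition EHA_sBR {G} (P : fm G) : Prop := EHA_ax P \/ sBR_ax P.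

(** Many-sorted intuitionistic predicate logic with equality over the axioms
    [Ax]; [H] lists the open assumptions. *)
Inductive prv (Ax : forall G, fm G -> Prop) :
  forall G, list (fm G) -> fm G -> Prop :=
| p_hyp : forall G (H : list (fm G)) P, In P H -> prv Ax H P
| p_ax : forall G (H : list (fm G)) P, Ax G P -> prv Ax H P
| p_botE : forall G (H : list (fm G)) P, prv Ax H Bot -> prv Ax H P
| p_andI : forall G (H : list (fm G)) P Q,
    prv Ax H P -> prv Ax H Q -> prv Ax H (And P Q)
| p_andE1 : forall G (H : list (fm G)) P Q, prv Ax H (And P Q) -> prv Ax H P
| p_andE2 : forall G (H : list (fm G)) P Q, prv Ax H (And P Q) -> prv Ax H Q
| p_orI1 : forall G (H : list (fm G)) P Q, prv Ax H P -> prv Ax H (Or P Q)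
| p_orI2 : forall G (H : list (fm G)) P Q, prv Ax H Q -> prv Ax H (Or P Q)
| p_orE : forall G (H : list (fm G)) P Q C,
    prv Ax H (Or P Q) -> prv Ax (P :: H) C -> prv Ax (Q :: H) C -> prv Ax H C
| p_impI : forall G (H : list (fm G)) P Q,
    prv Ax (P :: H) Q -> prv Ax H (Imp P Q)
| p_impE : forall G (H : list (fm G)) P Q,
    prv Ax H (Imp P Q) -> prv Ax H P -> prv Ax H Q
| p_allI : forall G (H : list (fm G)) A (P : fm (A :: G)),
    prv Ax (map fwk H) P -> prv Ax H (All A P)
| p_allE : forall G (H : list (fm G)) A (P : fm (A :: G)) t,
    prv Ax H (All A P) -> prv Ax H (finst P t)
| p_exI : forall G (H : list (fm G)) A (P : fm (A :: G)) t,
    prv Ax H (finst P t) -> prv Ax H (Ex A P)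
| p_exE : forall G (H : list (fm G)) A (P : fm (A :: G)) C,
    prv Ax H (Ex A P) -> prv Ax (P :: map fwk H) (fwk C) -> prv Ax H C
| p_refl : forall G (H : list (fm G)) A (t : tm G A), prv Ax H (Eq t t)
| p_leibniz : forall G (H : list (fm G)) A (t u : tm G A) (P : fm (A :: G)),
    prv Ax H (Eq t u) -> prv Ax H (finst P t) -> prv Ax H (finst P u).

Definition EHA_sBR_proves (P : fm []) : Prop := prv (@EHA_sBR) [] P.

Definition BR_ty (X R : ty) : ty :=
  (X^* ⇒ (X ⇒ R) ⇒ R) ⇒ (X^* ⇒ R) ⇒ ((TN ⇒ X) ⇒ TN) ⇒ X^* ⇒ R.

Definition BR_eqn {G X R} (Delta : tm G (BR_ty X R))
    (phi : tm G (X^* ⇒ (X ⇒ R) ⇒ R)) (b : tm G (X^* ⇒ R))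
    (f : tm G ((TN ⇒ X) ⇒ TN)) (s : tm G X^*) : fm G :=
  let rec := Delta · phi · b · f in
  Cases (Lt (f · seq_hat s) (len s))
    (Eq (rec · s) (b · s))
    (Eq (rec · s) (phi · s · Lam (wk rec · snoc (wk s) v0))).

Definition defines_BR {X R} (Delta : tm [] (BR_ty X R)) : fm [] :=
  All (X^* ⇒ (X ⇒ R) ⇒ R)
  (All (X^* ⇒ R)
  (All ((TN ⇒ X) ⇒ TN)
  (All X^*
    (BR_eqn (closed Delta) v3 v2 v1 v0)))).

(* Main.v *)
Require Import Defs.
From Stdlib Require Import List Setoid Morphisms.
Import ListNotations.

Set Implicit Arguments.

(** A sequence [s] is coded as the finite partial function [enc s] with domain
    [{k | k < |s|}] and values [(s_k, 1)].  Since undefined entries of the total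
    extension carry the flag [0], the control functional for sBR can read off
    from [alpha] the least [n <= f (fst . alpha)] with flag [0]: on [enc s] it
    returns [min (f s^) |s|], which is in the domain exactly when [f s^ < |s|]
    and is otherwise the next position [|s|] to be filled.  Hence sBR, with
    branching restricted to values flagged [1], runs through codes of sequences
    just as Spector's recursor runs through the sequences. *)

(** * Renaming and substitution *)

(** Direct case analysis is blocked by the index [C :: G], so the return type inspects the context
    and keeps the motive only for nonempty ones. Substitutions on an extended context are compared
    pointwise through it. *)
Lemma var_case (C : ty) (G : ctx) (P : forall A, var (C :: G) A -> Prop) :
  P C vz -> (forall A (v : var G A), P A (vs v)) -> forall A v, P A v.
Proof.
  intros Hz Hs A v.
  refine (match v as v' in var G' A' return
    match G' return var G' A' -> Prop with
    | nil => fun _ => True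
    | C' :: G0 => fun w => forall P : forall A, var (C' :: G0) A -> Prop,
        P C' vz -> (forall A (v : var G0 A), P A (vs v)) -> P A' w
    end v' with vz => _ | vs w => _ end P Hz Hs); intros; auto.
Qed.

Lemma rename_ext G A (t : tm G A) : forall D (r r' : ren G D),
  (forall B v, r B v = r' B v) -> rename r t = rename r' t.
Proof.
  induction t as [G A v|G A c|G A B t IHt u IHu|G A B t IHt];
    intros D r r' E; cbn; f_equal; auto.
  apply IHt. apply var_case; cbn; intros; f_equal; auto.
Qed.

Lemma subst_ext G A (t : tm G A) : forall D (s s' : sub G D),
  (forall B v, s B v = s' B v) -> subst s t = subst s' t.
Proof.
  induction t as [G A v|G A c|G A B t IHt u IHu|G A B t IHt];
    intros D s s' E; cbn; f_equal; auto.
  apply IHt. apply var_case; cbn; intros; f_equal; auto.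
Qed.

Lemma rename_rename G A (t : tm G A) : forall D F (r : ren G D) (q : ren D F),
  rename q (rename r t) = rename (fun B v => q B (r B v)) t.
Proof.
  induction t as [G A v|G A c|G A B t IHt u IHu|G A B t IHt];
    intros; cbn; f_equal; auto.
  rewrite IHt. apply rename_ext. apply var_case; reflexivity.
Qed.

Lemma subst_rename G A (t : tm G A) : forall D F (r : ren G D) (s : sub D F),
  subst s (rename r t) = subst (fun B v => s B (r B v)) t.
Proof.
  induction t as [G A v|G A c|G A B t IHt u IHu|G A B t IHt];
    intros; cbn; f_equal; auto.
  rewrite IHt. apply subst_ext. apply var_case; reflexivity.
Qed.

Lemma rename_up_wk G D A C (r : ren G D) (t : tm G A) :
  rename (up_ren r) (wk (C := C) t) = wk (rename r t).
Proof. unfold wk. now rewrite !rename_rename. Qed.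

Lemma rename_subst G A (t : tm G A) : forall D F (s : sub G D) (r : ren D F),
  rename r (subst s t) = subst (fun B v => rename r (s B v)) t.
Proof.
  induction t as [G A v|G A c|G A B t IHt u IHu|G A B t IHt];
    intros; cbn; f_equal; auto.
  rewrite IHt. apply subst_ext. apply var_case; cbn; auto using rename_up_wk.
Qed.

Lemma subst_up_wk G D A C (s : sub G D) (t : tm G A) :
  subst (up_sub s) (wk (C := C) t) = wk (subst s t).
Proof. unfold wk. now rewrite subst_rename, rename_subst. Qed.

Lemma subst_subst G A (t : tm G A) : forall D F (s : sub G D) (q : sub D F),
  subst q (subst s t) = subst (fun B v => subst q (s B v)) t.
Proof.
  induction t as [G A v|G A c|G A B t IHt u IHu|G A B t IHt];
    intros; cbn; f_equal; auto.
  rewrite IHt. apply subst_ext. apply var_case; cbn; auto using subst_up_wk.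
Qed.

Lemma subst_Var G A (t : tm G A) : forall s : sub G G,
  (forall B v, s B v = Var v) -> subst s t = t.
Proof.
  induction t as [G A v|G A c|G A B t IHt u IHu|G A B t IHt];
    intros; cbn; f_equal; auto.
  apply IHt. apply var_case; cbn; intros; [|rewrite H]; reflexivity.
Qed.

Lemma subst_ren G D A (r : ren G D) (t : tm G A) :
  subst (fun B v => Var (r B v)) t = rename r t.
Proof.
  rewrite <- (@subst_Var G A t (fun B v => Var v)) at 2 by reflexivity.
  now rewrite rename_subst.
Qed.

Lemma subst_scons_wk G D A C (s : sub G D) (u : tm D C) (t : tm G A) :
  subst (scons u s) (wk t) = subst s t.
Proof. unfold wk. now rewrite subst_rename. Qed.

Lemma subst_sub1_wk G A C (u : tm G C) (t : tm G A) : subst (sub1 u) (wk t) = t.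
Proof. unfold sub1. rewrite subst_scons_wk. now apply subst_Var. Qed.

Lemma sub1_up_sub G D A C (s : sub G D) (u : tm D C) (t : tm (C :: G) A) :
  subst (sub1 u) (subst (up_sub s) t) = subst (scons u s) t.
Proof.
  rewrite subst_subst. apply subst_ext.
  apply var_case; cbn; auto using subst_sub1_wk.
Qed.

(** Normalises the step formulas [fstep1] and [fstep2] when the induction formula is itself an
    instance under [up_sub s]; [r] is then the shift past the new variables. *)
Lemma subst_scons_up_sub G D F A C (s : sub G D) (r : ren D F) (u : tm F C)
    (t : tm (C :: G) A) :
  subst (scons u (fun B v => Var (r B v))) (subst (up_sub s) t) =
  subst (scons u (fun B v => rename r (s B v))) t.
Proof.
  rewrite subst_subst. apply subst_ext. apply var_case; auto.
  intros. cbn. rewrite subst_scons_wk. apply subst_ren.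
Qed.

(** [canon] recurses on the type, so at a variable type it does not commute with substitution by
    computation. Hence the explicit lemmas for [seq_hat] that follow. *)
Lemma subst_canon X : forall G D (s : sub G D), subst s (canon X) = canon X.
Proof. induction X; intros; cbn; unfold tpair; f_equal; auto; f_equal; auto. Qed.

Lemma rename_canon X : forall G D (r : ren G D), rename r (canon X) = canon X.
Proof. induction X; intros; cbn; unfold tpair; f_equal; auto; f_equal; auto. Qed.

Lemma subst_seq_hat G D X (s : sub G D) (t : tm G X^*) :
  subst s (seq_hat t) = seq_hat (subst s t).
Proof. unfold seq_hat, seqrec. cbn. now rewrite subst_canon. Qed.

Lemma wk_seq_hat G X C (t : tm G X^*) :
  wk (C := C) (seq_hat t) = seq_hat (wk t).
Proof. unfold wk, seq_hat, seqrec. cbn. now rewrite rename_canon. Qed.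

(** * Derivable equality as a congruence *)

Notation "H ⊢ P" := (prv (@EHA_sBR) H P) (at level 70, no associativity).

Definition eqv {G} (H : list (fm G)) {A} (t u : tm G A) : Prop := H ⊢ Eq t u.

Lemma prv_weaken G (H : list (fm G)) P :
  H ⊢ P -> forall H', incl H H' -> H' ⊢ P.
Proof.
  induction 1; intros H' I.
  - apply p_hyp; auto.
  - now apply p_ax.
  - apply p_botE; auto.
  - apply p_andI; auto.
  - eapply p_andE1; eauto.
  - eapply p_andE2; eauto.
  - apply p_orI1; auto.
  - apply p_orI2; auto.
  - eapply p_orE; [eauto| |]; [apply IHprv2|apply IHprv3];
      intros Q' [->|]; cbn; auto.
  - apply p_impI. apply IHprv. intros Q' [->|]; cbn; auto.
  - eapply p_impE; eauto.
  - apply p_allI. apply IHprv. now apply incl_map.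
  - apply p_allE; auto.
  - eapply p_exI; eauto.
  - eapply p_exE; [eauto|]. apply IHprv2.
    intros Q' [->|HQ]; cbn; auto. right. revert Q' HQ. now apply incl_map.
  - apply p_refl.
  - eapply p_leibniz; eauto.
Qed.

Lemma eqv_weaken G (H : list (fm G)) P A (t u : tm G A) :
  eqv H t u -> eqv (P :: H) t u.
Proof. intros E. eapply prv_weaken; [exact E|]. now right. Qed.

Lemma eqv_hyp G (H : list (fm G)) A (t u : tm G A) :
  eqv (Eq t u :: H) t u.
Proof. apply p_hyp. now left. Qed.

Lemma eqv_ax G (H : list (fm G)) A (t u : tm G A) :
  EHA_ax (Eq t u) -> eqv H t u.
Proof. intros E. apply p_ax. now left. Qed.

Lemma eqv_subst G (H : list (fm G)) A B (a b : tm G A) (t : tm (A :: G) B) :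
  eqv H a b -> eqv H (subst (sub1 a) t) (subst (sub1 b) t).
Proof.
  (* The Leibniz predicate is [t(a) = t(x)] with the left side frozen by weakening; reflexivity is
     its instance at [a]. *)
  intros E. pose proof (@p_leibniz (@EHA_sBR) G H A a b
    (Eq (wk (subst (sub1 a) t)) t) E) as L.
  unfold finst in L. cbn in L. rewrite !subst_sub1_wk in L.
  apply L. apply p_refl.
Qed.

#[export] Instance eqv_equiv G (H : list (fm G)) A : Equivalence (@eqv G H A).
Proof.
  assert (S : forall t u : tm G A, eqv H t u -> eqv H u t).
  (* Symmetry transports reflexivity along the predicate [x = t]. Transitivity below transports
     [u = w] from [u] to [t] along [x = w]. *)
  { intros t u E. pose proof (@p_leibniz (@EHA_sBR) G H A t u
      (Eq v0 (wk t)) E) as L.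
    unfold finst in L. cbn in L. rewrite !subst_sub1_wk in L.
    apply L. apply p_refl. }
  split.
  - intros t. apply p_refl.
  - exact S.
  - intros t u w E F. pose proof (@p_leibniz (@EHA_sBR) G H A u t
      (Eq v0 (wk w)) (S _ _ E)) as L.
    unfold finst in L. cbn in L. rewrite !subst_sub1_wk in L. now apply L.
Qed.

#[export] Instance App_proper G (H : list (fm G)) A B :
  Proper (eqv H ==> eqv H ==> eqv H) (@App G A B).
Proof.
  intros f g E a b F. transitivity (g · a).
  - pose proof (@eqv_subst G H _ _ f g (v0 · wk a) E) as L.
    cbn in L. now rewrite !subst_sub1_wk in L.
  - pose proof (@eqv_subst G H _ _ a b (wk g · v0) F) as L.
    cbn in L. now rewrite !subst_sub1_wk in L.
Qed.

Lemma eqv_funext G (H : list (fm G)) A B (f g : tm G (A ⇒ B)) :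
  eqv (map fwk H) (wk f · v0) (wk g · v0) -> eqv H f g.
Proof.
  intros E. eapply p_impE; [apply p_ax; left; apply ax_funext|].
  now apply p_allI.
Qed.

Lemma beta G (H : list (fm G)) A B (t : tm (A :: G) B) (u : tm G A) :
  eqv H (Lam t · u) (subst (sub1 u) t).
Proof. apply eqv_ax, ax_beta. Qed.

(** The simultaneous substitution makes the reduct of a combinator (a body
    without other free variables) available by conversion. *)
Lemma beta2 G (H : list (fm G)) A B C (t : tm (B :: A :: G) C) a b :
  eqv H (Lam (Lam t) · a · b) (subst (scons b (sub1 a)) t).
Proof.
  rewrite (beta H (Lam t) a). cbn. rewrite beta.
  rewrite sub1_up_sub. reflexivity.
Qed.

Lemma beta3 G (H : list (fm G)) A B C D (t : tm (C :: B :: A :: G) D) a b c :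
  eqv H (Lam (Lam (Lam t)) · a · b · c) (subst (scons c (scons b (sub1 a))) t).
Proof.
  rewrite (beta2 H (Lam t)). cbn. rewrite beta.
  rewrite sub1_up_sub. reflexivity.
Qed.

Lemma beta4 G (H : list (fm G)) A B C D E (t : tm (D :: C :: B :: A :: G) E)
    a b c d :
  eqv H (Lam (Lam (Lam (Lam t))) · a · b · c · d)
    (subst (scons d (scons c (scons b (sub1 a)))) t).
Proof.
  rewrite (beta3 H (Lam t)). cbn. rewrite beta.
  rewrite sub1_up_sub. reflexivity.
Qed.

(** The rule ξ is derived: applied to a fresh variable, both abstractions reduce to their bodies,
    and extensionality concludes. *)
Lemma eqv_Lam G (H : list (fm G)) A B (t u : tm (A :: G) B) :
  eqv (map fwk H) t u -> eqv H (Lam t) (Lam u).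
Proof.
  intros E. apply eqv_funext. unfold wk. cbn. rewrite !beta.
  unfold v0. rewrite !subst_rename.
  rewrite !subst_Var; auto; apply var_case; reflexivity.
Qed.

(** The operations are iterated applications of constants and closed abstractions, so their
    congruence is that of application. For this reason later definitions pass parameters to closed
    combinators. *)
Ltac congr := repeat intro;
  repeat (first [assumption | reflexivity | apply App_proper]).

#[export] Instance succ_proper G (H : list (fm G)) :
  Proper (eqv H ==> eqv H) (@succ G).
Proof. congr. Qed.
#[export] Instance ite_proper G (H : list (fm G)) A :
  Proper (eqv H ==> eqv H ==> eqv H ==> eqv H) (@ite G A).
Proof. congr. Qed.
#[export] Instance tfst_proper G (H : list (fm G)) A B :
  Proper (eqv H ==> eqv H) (@tfst G A B).
Proof. congr. Qed.
#[export] Instance tsnd_proper G (H : list (fm G)) A B :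
  Proper (eqv H ==> eqv H) (@tsnd G A B).
Proof. congr. Qed.
#[export] Instance snoc_proper G (H : list (fm G)) X :
  Proper (eqv H ==> eqv H ==> eqv H) (@snoc G X).
Proof. congr. Qed.
#[export] Instance dom_proper G (H : list (fm G)) Z :
  Proper (eqv H ==> eqv H ==> eqv H) (@dom G Z).
Proof. congr. Qed.
#[export] Instance pfn_hat_proper G (H : list (fm G)) Z :
  Proper (eqv H ==> eqv H) (@pfn_hat G Z).
Proof. congr. Qed.
#[export] Instance pred_proper G (H : list (fm G)) :
  Proper (eqv H ==> eqv H) (@pred G).
Proof. congr. Qed.
#[export] Instance add_proper G (H : list (fm G)) :
  Proper (eqv H ==> eqv H ==> eqv H) (@add G).
Proof. congr. Qed.
#[export] Instance is_zero_proper G (H : list (fm G)) :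
  Proper (eqv H ==> eqv H) (@is_zero G).
Proof. congr. Qed.
#[export] Instance eqb_proper G (H : list (fm G)) :
  Proper (eqv H ==> eqv H ==> eqv H) (@eqb G).
Proof. congr. Qed.

(** * Booleans and case distinction *)

Lemma ite_true G (H : list (fm G)) A (c : tm G TB) (a b : tm G A) :
  eqv H c ttrue -> eqv H (ite c a b) a.
Proof. intros ->. apply eqv_ax, ax_if_true. Qed.

Lemma ite_false G (H : list (fm G)) A (c : tm G TB) (a b : tm G A) :
  eqv H c tfalse -> eqv H (ite c a b) b.
Proof. intros ->. apply eqv_ax, ax_if_false. Qed.

(** A conditional with branches [1] and [0] turns the hypothesis into [1 = 0]. *)
Lemma true_neq_false G (H : list (fm G)) P : eqv H ttrue tfalse -> H ⊢ P.
Proof.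
  intros E. apply p_botE.
  eapply p_impE; [apply p_ax; left; apply (ax_succ_neq zeroN)|].
  change (eqv H (succ zeroN) zeroN).
  rewrite <- (ite_true (succ zeroN) zeroN (p_refl _ H ttrue)), E.
  apply ite_false. reflexivity.
Qed.

Lemma bool_case G (H : list (fm G)) P (c : tm G TB) :
  Eq c ttrue :: H ⊢ P -> Eq c tfalse :: H ⊢ P -> H ⊢ P.
Proof.
  intros T F. eapply p_orE; [|exact T|exact F].
  change (H ⊢ finst (Or (Eq v0 ttrue) (Eq v0 tfalse)) c).
  apply p_allE. eapply p_impE; [eapply p_impE|].
  - apply p_ax. left. apply ax_ind_bool.
  - apply p_orI2, p_refl.
  - apply p_orI1, p_refl.
Qed.

(** Carries the known equations into each branch and then makes the assumption list opaque, so that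
    rewriting does not enter it. *)
Ltac bcase b E :=
  apply (@bool_case _ _ _ b);
  match goal with |- ?Q :: ?H ⊢ ?P =>
    repeat match goal with
           | F : eqv H _ _ |- _ => apply (eqv_weaken Q) in F
           end;
    pose proof (@eqv_hyp _ H _ _ _ : eqv (Q :: H) _ _) as E;
    let K := fresh "H" in set (K := Q :: H) in *; clearbody K
  end;
  match goal with
  | |- ?H ⊢ Eq ?t ?u => change (eqv H t u)
  | _ => idtac
  end.

(** * Induction rules for equations *)

(** Parameters are variables of [D] instantiated by [s]. With concrete [t] and [u], the instances at
    zero, successor and [n] then compute, and a conversion restores readable terms. *)
Lemma nat_ind_eqv G D (H : list (fm G)) A (s : sub D G) (t u : tm (TN :: D) A) :
  eqv H (subst (scons zeroN s) t) (subst (scons zeroN s) u) ->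
  eqv (Eq (subst (up_sub s) t) (subst (up_sub s) u) :: map fwk H)
    (subst (scons (succ v0) (fun B v => wk (s B v))) t)
    (subst (scons (succ v0) (fun B v => wk (s B v))) u) ->
  forall n, eqv H (subst (scons n s) t) (subst (scons n s) u).
Proof.
  intros Z S n. rewrite <- !sub1_up_sub.
  change (H ⊢ finst (Eq (subst (up_sub s) t) (subst (up_sub s) u)) n).
  apply p_allE. eapply p_impE; [eapply p_impE|].
  - apply p_ax. left. apply ax_ind_nat.
  - unfold finst. cbn. now rewrite !sub1_up_sub.
  - apply p_allI, p_impI. unfold fstep1. cbn.
    rewrite !(@subst_scons_up_sub D G (TN :: G) _ _ s (fun B v => vs v)).
    exact S.
Qed.

Lemma eqv_subst_ext G D (H : list (fm D)) A (s s' : sub G D) (t u : tm G A) :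
  (forall B v, s B v = s' B v) ->
  eqv H (subst s t) (subst s u) -> eqv H (subst s' t) (subst s' u).
Proof. intros E. now rewrite (subst_ext t _ _ E), (subst_ext u _ _ E). Qed.

Lemma seq_ind_eqv G D (H : list (fm G)) X A (s : sub D G)
    (t u : tm (X^* :: D) A) :
  eqv H (subst (scons tnil s) t) (subst (scons tnil s) u) ->
  eqv (Eq (wk (subst (up_sub s) t)) (wk (subst (up_sub s) u))
         :: map fwk (map fwk H))
    (subst (scons (snoc v1 v0) (fun B v => wk (wk (s B v)))) t)
    (subst (scons (snoc v1 v0) (fun B v => wk (wk (s B v)))) u) ->
  forall l, eqv H (subst (scons l s) t) (subst (scons l s) u).
Proof.
  intros Z S l. rewrite <- !sub1_up_sub.
  change (H ⊢ finst (Eq (subst (up_sub s) t) (subst (up_sub s) u)) l).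
  apply p_allE. eapply p_impE; [eapply p_impE|].
  - apply p_ax. left. apply ax_ind_seq.
  - unfold finst. cbn. now rewrite !sub1_up_sub.
  - apply p_allI, p_allI, p_impI. unfold fstep2. cbn.
    rewrite !(@subst_scons_up_sub D G (X :: X^* :: G) _ _ s
      (fun B v => vs (vs v))).
    refine (eqv_subst_ext _ _ t u _ S); apply var_case; auto; intros; cbn;
    apply rename_rename.
Qed.

(** After an induction rule: names the induction hypothesis [l = r], restates the
    goal as [l' = r'], and hides the list of assumptions so that rewriting does
    not enter it. *)
Tactic Notation "step" uconstr(l) uconstr(r) uconstr(l') uconstr(r') "as" ident(E) :=
  match goal with |- eqv ?K _ _ =>
    pose proof (@eqv_hyp _ _ _ _ _ : eqv K l r) as E;
    change (eqv K l' r'); revert E; generalize K; intros ? E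
  end.

Lemma nat_case_eqv G D (H : list (fm G)) A (s : sub D G) (t u : tm (TN :: D) A) :
  eqv H (subst (scons zeroN s) t) (subst (scons zeroN s) u) ->
  eqv (map fwk H)
    (subst (scons (succ v0) (fun B v => wk (s B v))) t)
    (subst (scons (succ v0) (fun B v => wk (s B v))) u) ->
  forall n, eqv H (subst (scons n s) t) (subst (scons n s) u).
Proof. intros Z S. apply nat_ind_eqv; auto using eqv_weaken. Qed.

(** Double induction needs the hypothesis for all [n], which an equation can express only between
    functions. The cases arise under different binders, so the premises range over all contexts and
    assumption lists. *)
Lemma nat_ind2_eqv G (H : list (fm G)) A (t u : tm (TN :: TN :: G) A) :
  (forall D (r : ren G D) H' n,
    eqv (G := D) H' (subst (scons n (scons zeroN (fun B v => Var (r B v)))) t)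
      (subst (scons n (scons zeroN (fun B v => Var (r B v)))) u)) ->
  (forall D (r : ren G D) H' m,
    eqv (G := D) H'
      (subst (scons zeroN (scons (succ m) (fun B v => Var (r B v)))) t)
      (subst (scons zeroN (scons (succ m) (fun B v => Var (r B v)))) u)) ->
  (forall D (r : ren G D) H' m n,
    eqv (G := D) H' (subst (scons n (scons m (fun B v => Var (r B v)))) t)
      (subst (scons n (scons m (fun B v => Var (r B v)))) u) ->
    eqv (G := D) H'
      (subst (scons (succ n) (scons (succ m) (fun B v => Var (r B v)))) t)
      (subst (scons (succ n) (scons (succ m) (fun B v => Var (r B v)))) u)) ->
  forall m n,
    eqv H (subst (scons n (sub1 m)) t) (subst (scons n (sub1 m)) u).
Proof.
  intros Z0 S0 SS m n.
  (* Induction on [m] for the equation of the abstractions over [n], with a case distinction on [n]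
     inside. *)
  assert (F : eqv H (subst (sub1 m) (Lam t)) (subst (sub1 m) (Lam u))).
  { apply (@nat_ind_eqv G G H _ (fun B v => Var v) (Lam t) (Lam u)); cbn.
    - apply eqv_Lam.
      refine (eqv_subst_ext _ _ t u _ (Z0 _ (fun B v => vs v) _ v0)).
      do 2 (apply var_case; [reflexivity|]); reflexivity.
    - apply eqv_Lam.
      apply (@nat_case_eqv _ (TN :: G) _ _ (fun B v => wk (scons (succ v0)
        (fun B v => wk (Var v)) v)) t u).
      + refine (eqv_subst_ext _ _ t u _ (S0 _ (fun B v => vs (vs v)) _ v1)).
        do 2 (apply var_case; [reflexivity|]); reflexivity.
      + refine (eqv_subst_ext _ _ t u _ (SS _ (fun B v => vs (vs (vs v))) _ v2 v0 _)).
        { do 2 (apply var_case; [reflexivity|]); reflexivity. }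
        (* Applying the hypothesis on functions to the predecessor of [n] yields the equation at
           [(m, n)] that [SS] asks for. *)
        cbn. match goal with |- eqv ?K _ _ =>
          pose proof (App_proper (@eqv_hyp _ _ _ _ _ : eqv K _ _)
            (p_refl _ K v0)) as E end.
        cbn in E. rewrite !beta in E.
        rewrite !subst_rename, !subst_subst in E.
        refine (eqv_subst_ext _ _ t u _ E).
        do 2 (apply var_case; [reflexivity|]); reflexivity. }
  pose proof (App_proper F (p_refl _ H n)) as E. cbn in E.
  rewrite !beta, !sub1_up_sub in E. exact E.
Qed.

(** * Computation rules and arithmetic *)

Lemma natrec_zero G (H : list (fm G)) A (a : tm G A) f :
  eqv H (natrec a f zeroN) a.
Proof. apply eqv_ax, ax_rec_zero. Qed.

Lemma natrec_succ G (H : list (fm G)) A (a : tm G A) f n :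
  eqv H (natrec a f (succ n)) (f · n · natrec a f n).
Proof. apply eqv_ax, ax_rec_succ. Qed.

Lemma seqrec_nil G (H : list (fm G)) X A (a : tm G A)
    (f : tm G (X^* ⇒ X ⇒ A ⇒ A)) :
  eqv H (seqrec a f tnil) a.
Proof. apply eqv_ax, ax_seqrec_nil. Qed.

Lemma seqrec_snoc G (H : list (fm G)) X A (a : tm G A)
    (f : tm G (X^* ⇒ X ⇒ A ⇒ A)) s x :
  eqv H (seqrec a f (snoc s x)) (f · s · x · seqrec a f s).
Proof. apply eqv_ax, ax_seqrec_snoc. Qed.

Lemma fst_pair G (H : list (fm G)) A B (a : tm G A) (b : tm G B) :
  eqv H (tfst (tpair a b)) a.
Proof. apply eqv_ax, ax_fst. Qed.

Lemma snd_pair G (H : list (fm G)) A B (a : tm G A) (b : tm G B) :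
  eqv H (tsnd (tpair a b)) b.
Proof. apply eqv_ax, ax_snd. Qed.

Lemma add_zero G (H : list (fm G)) (m : tm G TN) : eqv H (add m zeroN) m.
Proof. apply natrec_zero. Qed.

Lemma add_succ G (H : list (fm G)) (m n : tm G TN) :
  eqv H (add m (succ n)) (succ (add m n)).
Proof. unfold add at 1. rewrite natrec_succ. apply beta2. Qed.

Lemma pred_zero G (H : list (fm G)) : eqv H (pred zeroN) zeroN.
Proof. apply natrec_zero. Qed.

Lemma pred_succ G (H : list (fm G)) (n : tm G TN) : eqv H (pred (succ n)) n.
Proof. unfold pred. rewrite natrec_succ. apply beta2. Qed.

Lemma monus_zero G (H : list (fm G)) (m : tm G TN) : eqv H (monus m zeroN) m.
Proof. apply natrec_zero. Qed.

Lemma monus_succ G (H : list (fm G)) (m n : tm G TN) :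
  eqv H (monus m (succ n)) (pred (monus m n)).
Proof. unfold monus at 1. rewrite natrec_succ. apply beta2. Qed.

Lemma is_zero_zero G (H : list (fm G)) : eqv H (is_zero zeroN) ttrue.
Proof. apply natrec_zero. Qed.

Lemma is_zero_succ G (H : list (fm G)) (n : tm G TN) :
  eqv H (is_zero (succ n)) tfalse.
Proof. unfold is_zero. rewrite natrec_succ. apply beta2. Qed.

(** The induction rules prove only equations, so an implication is encoded as one: its premise
    becomes the test of a conditional. [eqb_true], [ltb_succ_neq] and [take_upd] use the same
    device. *)
Lemma is_zero_true G (H : list (fm G)) (n : tm G TN) :
  eqv H (is_zero n) ttrue -> eqv H n zeroN.
Proof.
  intros E.
  assert (F : eqv H n (ite (is_zero n) zeroN n)).
  { apply (@nat_case_eqv _ G _ _ (fun B v => Var v)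
      v0 (ite (is_zero v0) zeroN v0)).
    - change (eqv H zeroN (ite (is_zero zeroN) zeroN zeroN)).
      rewrite ite_true; [reflexivity|apply is_zero_zero].
    - change (eqv (map fwk H) (succ v0)
        (ite (is_zero (succ v0)) zeroN (succ v0))).
      rewrite ite_false; [reflexivity|apply is_zero_succ]. }
  rewrite F. now apply ite_true.
Qed.

Lemma monus_succ_succ G (H : list (fm G)) (m n : tm G TN) :
  eqv H (monus (succ m) (succ n)) (monus m n).
Proof.
  apply (@nat_ind_eqv _ _ _ _ (sub1 m)
    (monus (succ v1) (succ v0)) (monus v1 v0)).
  - change (eqv H (monus (succ m) (succ zeroN)) (monus m zeroN)).
    now rewrite monus_succ, !monus_zero, pred_succ.
  - step (monus (succ (wk m)) (succ v0)) (monus (wk m) v0)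
      (monus (succ (wk m)) (succ (succ v0))) (monus (wk m) (succ v0)) as E.
    now rewrite monus_succ, E, monus_succ.
Qed.

Lemma monus_zero_l G (H : list (fm G)) (n : tm G TN) :
  eqv H (monus zeroN n) zeroN.
Proof.
  apply (@nat_ind_eqv _ G _ _ (fun B v => Var v) (monus zeroN v0) zeroN).
  - apply monus_zero.
  - step (monus zeroN v0) zeroN (monus zeroN (succ v0)) zeroN as E.
    now rewrite monus_succ, E, pred_zero.
Qed.

(** Tests the very term that [Lt] equates with zero, which makes the passage between the formula and
    the boolean immediate. *)
Definition ltb {G} (k n : tm G TN) : tm G TB := is_zero (monus (succ k) n).

#[export] Instance ltb_proper G (H : list (fm G)) :
  Proper (eqv H ==> eqv H ==> eqv H) (@ltb G).
Proof. congr. Qed.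

Lemma ltb_zero G (H : list (fm G)) (k : tm G TN) :
  eqv H (ltb k zeroN) tfalse.
Proof. unfold ltb. now rewrite monus_zero, is_zero_succ. Qed.

Lemma ltb_zero_succ G (H : list (fm G)) (n : tm G TN) :
  eqv H (ltb zeroN (succ n)) ttrue.
Proof.
  unfold ltb. now rewrite monus_succ_succ, monus_zero_l, is_zero_zero.
Qed.

Lemma ltb_succ_succ G (H : list (fm G)) (k n : tm G TN) :
  eqv H (ltb (succ k) (succ n)) (ltb k n).
Proof. unfold ltb. now rewrite monus_succ_succ. Qed.

Lemma ltb_irrefl G (H : list (fm G)) (n : tm G TN) : eqv H (ltb n n) tfalse.
Proof.
  apply (@nat_ind_eqv _ G _ _ (fun B v => Var v) (ltb v0 v0) tfalse).
  - apply ltb_zero.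
  - step (ltb v0 v0) tfalse (ltb (succ v0) (succ v0)) tfalse as E.
    now rewrite ltb_succ_succ.
Qed.

Lemma ltb_succ_diag G (H : list (fm G)) (n : tm G TN) :
  eqv H (ltb n (succ n)) ttrue.
Proof.
  apply (@nat_ind_eqv _ G _ _ (fun B v => Var v) (ltb v0 (succ v0)) ttrue).
  - apply ltb_zero_succ.
  - step (ltb v0 (succ v0)) ttrue (ltb (succ v0) (succ (succ v0))) ttrue as E.
    now rewrite ltb_succ_succ.
Qed.

Lemma eqb_succ_succ G (H : list (fm G)) (m n : tm G TN) :
  eqv H (eqb (succ m) (succ n)) (eqb m n).
Proof. unfold eqb. now rewrite !monus_succ_succ. Qed.

Lemma eqb_zero_succ G (H : list (fm G)) (n : tm G TN) :
  eqv H (eqb zeroN (succ n)) tfalse.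
Proof.
  unfold eqb.
  now rewrite monus_zero_l, monus_zero, add_succ, is_zero_succ.
Qed.

Lemma eqb_succ_zero G (H : list (fm G)) (n : tm G TN) :
  eqv H (eqb (succ n) zeroN) tfalse.
Proof.
  unfold eqb.
  now rewrite monus_zero_l, monus_zero, add_zero, is_zero_succ.
Qed.

Lemma eqb_zero_zero G (H : list (fm G)) : eqv H (eqb zeroN zeroN) ttrue.
Proof. unfold eqb. now rewrite !monus_zero, add_zero, is_zero_zero. Qed.

Lemma eqb_refl G (H : list (fm G)) (n : tm G TN) : eqv H (eqb n n) ttrue.
Proof.
  apply (@nat_ind_eqv _ G _ _ (fun B v => Var v) (eqb v0 v0) ttrue).
  - apply eqb_zero_zero.
  - step (eqb v0 v0) ttrue (eqb (succ v0) (succ v0)) ttrue as E.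
    now rewrite eqb_succ_succ.
Qed.

Lemma eqb_true G (H : list (fm G)) (m n : tm G TN) :
  eqv H (eqb m n) ttrue -> eqv H m n.
Proof.
  intros E.
  assert (F : eqv H (ite (eqb m n) m n) n).
  { apply (@nat_ind2_eqv _ H _ (ite (eqb v1 v0) v1 v0) v0); clear.
    - intros D r H n.
      refine (@nat_case_eqv _ D _ _ (fun B v => Var v)
        (ite (eqb zeroN v0) zeroN v0) v0 _ _ n).
      + apply ite_true, eqb_zero_zero.
      + apply ite_false, eqb_zero_succ.
    - intros D r H m. apply ite_false, eqb_succ_zero.
    - intros D r H m n E.
      change (eqv H (ite (eqb m n) m n) n) in E.
      change (eqv H (ite (eqb (succ m) (succ n)) (succ m) (succ n)) (succ n)).
      rewrite eqb_succ_succ. bcase (eqb m n) F.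
      + rewrite ite_true in E by exact F. rewrite ite_true by exact F.
        now rewrite E.
      + now apply ite_false. }
  rewrite <- F. symmetry. now apply ite_true.
Qed.

Lemma eqb_false_sym G (H : list (fm G)) (m n : tm G TN) :
  eqv H (eqb m n) tfalse -> eqv H (eqb n m) tfalse.
Proof.
  intros E. bcase (eqb n m) F; [|exact F].
  apply true_neq_false. rewrite <- E.
  rewrite (eqb_true F). symmetry. apply eqb_refl.
Qed.

Lemma ltb_succ_neq G (H : list (fm G)) (m n : tm G TN) :
  eqv H (eqb m n) tfalse -> eqv H (ltb m (succ n)) (ltb m n).
Proof.
  intros E.
  (* In the excluded case [m = n] the conditional returns the right-hand side itself. *)
  assert (F : eqv H (ite (eqb m n) (ltb m n) (ltb m (succ n))) (ltb m n)).
  { apply (@nat_ind2_eqv _ H _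
      (ite (eqb v1 v0) (ltb v1 v0) (ltb v1 (succ v0))) (ltb v1 v0)); clear.
    - intros D r H n.
      refine (@nat_case_eqv _ D _ _ (fun B v => Var v)
        (ite (eqb zeroN v0) (ltb zeroN v0) (ltb zeroN (succ v0)))
        (ltb zeroN v0) _ _ n).
      + apply ite_true, eqb_zero_zero.
      + match goal with |- eqv ?K _ _ => change (eqv K
          (ite (eqb zeroN (succ v0)) (ltb zeroN (succ v0))
            (ltb zeroN (succ (succ v0)))) (ltb zeroN (succ v0))) end.
        rewrite ite_false by apply eqb_zero_succ.
        now rewrite !ltb_zero_succ.
    - intros D r H m.
      change (eqv H (ite (eqb (succ m) zeroN) (ltb (succ m) zeroN)
        (ltb (succ m) (succ zeroN))) (ltb (succ m) zeroN)).
      rewrite ite_false by apply eqb_succ_zero.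
      now rewrite ltb_succ_succ, !ltb_zero.
    - intros D r H m n E.
      change (eqv H (ite (eqb m n) (ltb m n) (ltb m (succ n))) (ltb m n)) in E.
      change (eqv H (ite (eqb (succ m) (succ n)) (ltb (succ m) (succ n))
        (ltb (succ m) (succ (succ n)))) (ltb (succ m) (succ n))).
      now rewrite eqb_succ_succ, !ltb_succ_succ. }
  rewrite <- F. symmetry. now apply ite_false.
Qed.

(** * Function updates, initial segments and bounded search *)

(** Isolates the step of [seq_hat]: appending [x] overwrites the default value at position
    [len s]. *)
Definition upd {G X} (a : tm G (TN ⇒ X)) (n : tm G TN) (x : tm G X)
  : tm G (TN ⇒ X) :=
  Lam (Lam (Lam (Lam (ite (eqb v0 v2) v1 (v3 · v0))))) · a · n · x.

Lemma upd_app G (H : list (fm G)) X (a : tm G (TN ⇒ X)) n x k :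
  eqv H (upd a n x · k) (ite (eqb k n) x (a · k)).
Proof. apply beta4. Qed.

Lemma len_nil G (H : list (fm G)) X : eqv H (len (@tnil G X)) zeroN.
Proof. apply seqrec_nil. Qed.

Lemma len_snoc G (H : list (fm G)) X (s : tm G X^*) x :
  eqv H (len (snoc s x)) (succ (len s)).
Proof. unfold len at 1. rewrite seqrec_snoc. apply beta3. Qed.

Lemma seq_hat_nil G (H : list (fm G)) X k :
  eqv H (seq_hat (@tnil G X) · k) (canon X).
Proof.
  unfold seq_hat. rewrite seqrec_nil, beta, subst_canon. reflexivity.
Qed.

Lemma seq_hat_snoc G (H : list (fm G)) X (s : tm G X^*) x :
  eqv H (seq_hat (snoc s x)) (upd (seq_hat s) (len s) x).
Proof.
  unfold seq_hat at 1. rewrite seqrec_snoc. fold (seq_hat s).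
  unfold upd. rewrite !beta3. reflexivity.
Qed.

Definition take {G X} (a : tm G (TN ⇒ X)) (n : tm G TN) : tm G X^* :=
  natrec tnil (Lam (Lam (Lam (snoc v0 (v2 · v1)))) · a) n.

#[export] Instance take_proper G (H : list (fm G)) X :
  Proper (eqv H ==> eqv H ==> eqv H) (@take G X).
Proof. congr. Qed.

Lemma take_zero G (H : list (fm G)) X (a : tm G (TN ⇒ X)) :
  eqv H (take a zeroN) tnil.
Proof. apply natrec_zero. Qed.

Lemma take_succ G (H : list (fm G)) X (a : tm G (TN ⇒ X)) n :
  eqv H (take a (succ n)) (snoc (take a n) (a · n)).
Proof. unfold take at 1. rewrite natrec_succ. apply beta3. Qed.

(** An initial segment of length [n] reads only positions below [n], and [m] is not one of them. *)
Lemma take_upd G (H : list (fm G)) X (a : tm G (TN ⇒ X)) m x n :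
  eqv H (ltb m n) tfalse -> eqv H (take (upd a m x) n) (take a n).
Proof.
  intros E.
  transitivity (ite (ltb m n) (take a n) (take (upd a m x) n));
    [symmetry; now apply ite_false|].
  clear E. apply (@nat_ind_eqv _ _ _ _ (scons x (scons m (sub1 a)))
    (ite (ltb v2 v0) (take v3 v0) (take (upd v3 v2 v1) v0)) (take v3 v0)).
  - change (eqv H (ite (ltb m zeroN) (take a zeroN) (take (upd a m x) zeroN))
      (take a zeroN)).
    rewrite ite_false by apply ltb_zero. now rewrite !take_zero.
  - step (ite (ltb (wk m) v0) (take (wk a) v0)
        (take (upd (wk a) (wk m) (wk x)) v0)) (take (wk a) v0)
      (ite (ltb (wk m) (succ v0)) (take (wk a) (succ v0))
        (take (upd (wk a) (wk m) (wk x)) (succ v0)))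
      (take (wk a) (succ v0)) as E.
    bcase (eqb (wk m) (@v0 G TN)) F.
    (* At [m = n] the premise fails for length [n + 1], so the conditional takes its trivial
       branch. *)
    + apply ite_true. rewrite (eqb_true F). apply ltb_succ_diag.
    + rewrite (ltb_succ_neq F). bcase (ltb (wk m) (@v0 G TN)) L.
      * now apply ite_true.
      * rewrite ite_false in E by exact L. rewrite ite_false by exact L.
        rewrite !take_succ, E, upd_app.
        rewrite ite_false by (now apply eqb_false_sym). reflexivity.
Qed.

Lemma take_seq_hat G (H : list (fm G)) X (s : tm G X^*) :
  eqv H (take (seq_hat s) (len s)) s.
Proof.
  pose (i := fun B (v : var G B) => Var v).
  (* [seq_hat] is written as an explicit substitution instance because it does not match the
     induction rule by conversion. *)
  replace (seq_hat s) with (subst (scons s i) (seq_hat v0))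
    by apply subst_seq_hat.
  apply (@seq_ind_eqv _ _ _ _ _ i (take (seq_hat v0) (len v0)) v0).
  - change (eqv H (take (subst (scons tnil i) (seq_hat (@v0 G X^*))) (len (@tnil G X))) tnil).
    rewrite len_nil. apply take_zero.
  - pose (l1 := @v1 G X^* X). pose (l2 := snoc l1 v0).
    step (take (wk (subst (up_sub i) (seq_hat (@v0 G X^*)))) (len l1)) l1
      (take (subst (scons l2 (fun B v => wk (wk (i B v))))
        (seq_hat (@v0 G X^*))) (len l2)) l2 as E.
    rewrite subst_seq_hat, wk_seq_hat in E. rewrite subst_seq_hat.
    change (eqv l (take (seq_hat l1) (len l1)) l1) in E.
    change (eqv l (take (seq_hat l2) (len l2))
      l2).
    unfold l2. rewrite len_snoc, take_succ, seq_hat_snoc, upd_app.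
    rewrite ite_true by apply eqb_refl.
    (* The update at [len s] is read only as the last entry; the preceding segment does not see
       it. *)
    now rewrite take_upd, E by apply ltb_irrefl.
Qed.

(** [search p n] is the least [k < n] with [p k] false, and [n] if there is
    none. *)
Definition search {G} (p : tm G (TN ⇒ TB)) (n : tm G TN) : tm G TN :=
  natrec zeroN (Lam (Lam (Lam (ite (v2 · v0) (succ v0) v0))) · p) n.

#[export] Instance search_proper G (H : list (fm G)) :
  Proper (eqv H ==> eqv H ==> eqv H) (@search G).
Proof. congr. Qed.

Lemma search_zero G (H : list (fm G)) (p : tm G (TN ⇒ TB)) :
  eqv H (search p zeroN) zeroN.
Proof. apply natrec_zero. Qed.

Lemma search_succ G (H : list (fm G)) (p : tm G (TN ⇒ TB)) n :
  eqv H (search p (succ n))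
    (ite (p · search p n) (succ (search p n)) (search p n)).
Proof. unfold search at 1. rewrite natrec_succ. apply beta3. Qed.

Definition below {G} (L : tm G TN) : tm G (TN ⇒ TB) :=
  Lam (Lam (ltb v0 v1)) · L.

Lemma below_app G (H : list (fm G)) (L k : tm G TN) :
  eqv H (below L · k) (ltb k L).
Proof. apply beta2. Qed.

(** The first failure of [k < L] is at [L], so the search returns the minimum of [n] and [L]. Both
    the control functional and the decoding rest on this. *)
Lemma search_below G (H : list (fm G)) (L n : tm G TN) :
  eqv H (search (below L) n) (ite (ltb n L) n L).
Proof.
  apply (@nat_ind_eqv _ _ _ _ (sub1 L)
    (search (below v1) v0) (ite (ltb v0 v1) v0 v1)).
  - change (eqv H (search (below L) zeroN) (ite (ltb zeroN L) zeroN L)).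
    rewrite search_zero.
    apply (@nat_case_eqv _ G _ _ (fun B v => Var v)
      zeroN (ite (ltb zeroN v0) zeroN v0)); symmetry.
    + apply ite_false, ltb_zero.
    + apply ite_true, ltb_zero_succ.
  - step (search (below (wk L)) v0) (ite (ltb v0 (wk L)) v0 (wk L))
      (search (below (wk L)) (succ v0))
      (ite (ltb (succ v0) (wk L)) (succ v0) (wk L)) as E.
    rewrite search_succ, E, below_app.
    (* Only at [n + 1 = L] do [n < L] and [n + 1 < L] differ; there both sides equal [L]. *)
    bcase (eqb (succ (@v0 G TN)) (wk L)) F.
    + apply eqb_true in F. rewrite <- F.
      rewrite !(ite_true _ _ (ltb_succ_diag _ v0)).
      rewrite !(ite_false _ _ (ltb_irrefl _ (succ v0))). reflexivity.
    + assert (S : eqv H0 (ltb (succ v0) (wk L)) (ltb v0 (wk L))).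
      { now rewrite <- (ltb_succ_neq F), ltb_succ_succ. }
      rewrite S. bcase (ltb (@v0 G TN) (wk L)) M.
      * rewrite !(ite_true _ _ M). reflexivity.
      * rewrite !(ite_false _ _ M). apply ite_false, ltb_irrefl.
Qed.

(** * Finite partial functions and the coding of sequences *)

Lemma not_in_dom G (H : list (fm G)) Z (u : tm G Z^†) n :
  eqv H (dom u n) tfalse -> H ⊢ Not (InDom n u).
Proof.
  intros E. apply p_impI. apply true_neq_false.
  rewrite <- (eqv_weaken _ E). symmetry. apply eqv_hyp.
Qed.

Lemma dom_emp G (H : list (fm G)) Z n : eqv H (dom (@emp G Z) n) tfalse.
Proof.
  bcase (dom (@emp G Z) n) E; [|exact E].
  apply p_botE. eapply p_impE; [|exact E].
  apply p_ax. left. apply ax_dom_emp.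
Qed.

Lemma hat_emp G (H : list (fm G)) Z n :
  eqv H (pfn_hat (@emp G Z) · n) (canon Z).
Proof.
  eapply p_impE; [apply p_ax; left; apply ax_hat_undef|].
  apply not_in_dom, dom_emp.
Qed.

Lemma ext_new G (H : list (fm G)) Z (u : tm G Z^†) n x :
  eqv H (dom u n) tfalse ->
  eqv H (dom (ext u n x) n) ttrue /\ eqv H (pfn_hat (ext u n x) · n) x.
Proof.
  intros E.
  assert (F : H ⊢ And (InDom n (ext u n x)) (Eq (pfn_hat (ext u n x) · n) x)).
  { eapply p_impE; [apply p_ax; left; apply ax_ext_new|].
    now apply not_in_dom. }
  split; [exact (p_andE1 F)|exact (p_andE2 F)].
Qed.

Lemma dom_ext_same G (H : list (fm G)) Z (u : tm G Z^†) n x :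
  eqv H (dom (ext u n x) n) ttrue.
Proof.
  bcase (dom u n) E; [|now apply ext_new].
  assert (F : eqv H0 (ext u n x) u).
  { eapply p_impE; [apply p_ax; left; apply ax_ext_old|exact E]. }
  now rewrite F.
Qed.

Lemma ext_other G (H : list (fm G)) Z (u : tm G Z^†) n x m :
  eqv H (eqb m n) tfalse ->
  eqv H (dom (ext u n x) m) (dom u m) /\
  eqv H (pfn_hat (ext u n x) · m) (pfn_hat u · m).
Proof.
  intros E.
  assert (F : H ⊢ And (Eq (dom (ext u n x) m) (dom u m))
                (Eq (pfn_hat (ext u n x) · m) (pfn_hat u · m))).
  { eapply p_impE; [apply p_ax; left; apply ax_ext_other|].
    apply p_impI, true_neq_false. apply (eqv_weaken (Eq m n)) in E.
    pose proof (eqv_hyp H m n) as F. revert E F. generalize (Eq m n :: H).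
    intros K E F. rewrite <- E, F. symmetry. apply eqb_refl. }
  split; [exact (p_andE1 F)|exact (p_andE2 F)].
Qed.

Definition enc {G X} (s : tm G X^*) : tm G (X ⊗ TB)^† :=
  seqrec emp (Lam (Lam (Lam (ext v0 (len v2) (tpair v1 ttrue))))) s.

Lemma enc_nil G (H : list (fm G)) X : eqv H (enc (@tnil G X)) emp.
Proof. apply seqrec_nil. Qed.

Lemma enc_snoc G (H : list (fm G)) X (s : tm G X^*) x :
  eqv H (enc (snoc s x)) (ext (enc s) (len s) (tpair x ttrue)).
Proof. unfold enc at 1. rewrite seqrec_snoc. apply beta3. Qed.

Lemma dom_enc G (H : list (fm G)) X (s : tm G X^*) k :
  eqv H (dom (enc s) k) (ltb k (len s)).
Proof.
  apply (@seq_ind_eqv _ _ _ _ _ (sub1 k)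
    (dom (enc v0) v1) (ltb v1 (len v0))).
  - change (eqv H (dom (enc (@tnil G X)) k) (ltb k (len (@tnil G X)))).
    now rewrite enc_nil, dom_emp, len_nil, ltb_zero.
  - pose (l1 := @v1 G X^* X). pose (x1 := @v0 (X^* :: G) X).
    step (dom (enc l1) (wk (wk k))) (ltb (wk (wk k)) (len l1))
      (dom (enc (snoc l1 x1)) (wk (wk k)))
      (ltb (wk (wk k)) (len (snoc l1 x1))) as E.
    rewrite enc_snoc, len_snoc.
    bcase (eqb (wk (wk k)) (len l1)) F.
    + apply eqb_true in F. now rewrite F, dom_ext_same, ltb_succ_diag.
    + rewrite (ltb_succ_neq F), <- E. now apply ext_other.
Qed.

Lemma dom_enc_len G (H : list (fm G)) X (s : tm G X^*) :
  eqv H (dom (enc s) (len s)) tfalse.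
Proof. rewrite dom_enc. apply ltb_irrefl. Qed.

(** Every written entry has flag [ttrue], while the default [canon (X ⊗ TB)] has flag [tfalse]. The
    total extension alone thus reveals the domain. *)
Lemma snd_enc G (H : list (fm G)) X (s : tm G X^*) k :
  eqv H (tsnd (pfn_hat (enc s) · k)) (ltb k (len s)).
Proof.
  apply (@seq_ind_eqv _ _ _ _ _ (sub1 k)
    (tsnd (pfn_hat (enc v0) · v1)) (ltb v1 (len v0))).
  - change (eqv H (tsnd (pfn_hat (enc (@tnil G X)) · k)) (ltb k (len (@tnil G X)))).
    rewrite enc_nil, hat_emp, len_nil, ltb_zero. apply snd_pair.
  - pose (l1 := @v1 G X^* X). pose (x1 := @v0 (X^* :: G) X).
    step (tsnd (pfn_hat (enc l1) · wk (wk k))) (ltb (wk (wk k)) (len l1))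
      (tsnd (pfn_hat (enc (snoc l1 x1)) · wk (wk k)))
      (ltb (wk (wk k)) (len (snoc l1 x1))) as E.
    rewrite enc_snoc, len_snoc.
    bcase (eqb (wk (wk k)) (len l1)) F.
    + apply eqb_true in F. rewrite F, ltb_succ_diag.
      rewrite (proj2 (ext_new _ (dom_enc_len _ l1))).
      apply snd_pair.
    + rewrite (ltb_succ_neq F), <- E. now rewrite (proj2 (ext_other _ _ F)).
Qed.

(** Beyond the domain both sides are [canon X], the first component of the default pair. *)
Lemma fst_enc G (H : list (fm G)) X (s : tm G X^*) k :
  eqv H (tfst (pfn_hat (enc s) · k)) (seq_hat s · k).
Proof.
  replace (seq_hat s) with (subst (scons s (sub1 k)) (seq_hat v0))
    by apply subst_seq_hat.
  apply (@seq_ind_eqv _ _ _ _ _ (sub1 k)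
    (tfst (pfn_hat (enc v0) · v1)) (seq_hat v0 · v1)).
  - change (eqv H (tfst (pfn_hat (enc (@tnil G X)) · k))
      (subst (scons tnil (sub1 k)) (seq_hat v0) · k)).
    rewrite subst_seq_hat. change (subst _ v0) with (@tnil G X).
    rewrite enc_nil, hat_emp, seq_hat_nil. apply fst_pair.
  - pose (l1 := @v1 G X^* X). pose (x1 := @v0 (X^* :: G) X).
    step (tfst (pfn_hat (enc l1) · wk (wk k)))
      (wk (subst (up_sub (sub1 k)) (seq_hat (@v0 (TN :: G) X^*))) · wk (wk k))
      (tfst (pfn_hat (enc (snoc l1 x1)) · wk (wk k)))
      (subst (scons (snoc l1 x1) (fun B v => wk (wk (sub1 k v))))
        (seq_hat (@v0 (TN :: G) X^*)) · wk (wk k)) as E.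
    rewrite subst_seq_hat, wk_seq_hat in E. rewrite subst_seq_hat.
    change (eqv l (tfst (pfn_hat (enc l1) · wk (wk k)))
      (seq_hat l1 · wk (wk k))) in E.
    change (subst _ v0) with (snoc l1 x1).
    rewrite enc_snoc, seq_hat_snoc, upd_app.
    bcase (eqb (wk (wk k)) (len l1)) F.
    + rewrite ite_true by exact F. apply eqb_true in F. rewrite F.
      rewrite (proj2 (ext_new _ (dom_enc_len _ l1))). apply fst_pair.
    + rewrite ite_false by exact F.
      now rewrite (proj2 (ext_other _ _ F)).
Qed.

(** * Decoding *)

Definition comp_fst {G X} (a : tm G (TN ⇒ X ⊗ TB)) : tm G (TN ⇒ X) :=
  Lam (Lam (tfst (v1 · v0))) · a.

Definition comp_snd {G X} (a : tm G (TN ⇒ X ⊗ TB)) : tm G (TN ⇒ TB) :=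
  Lam (Lam (tsnd (v1 · v0))) · a.

(** Extensionality turns pointwise agreement into an equality of functions, which may be rewritten
    inside the argument of an arbitrary [f]. *)
Lemma comp_fst_enc G (H : list (fm G)) X (s : tm G X^*) :
  eqv H (comp_fst (pfn_hat (enc s))) (seq_hat s).
Proof.
  apply eqv_funext. rewrite wk_seq_hat, <- fst_enc. apply beta2.
Qed.

Lemma comp_snd_enc G (H : list (fm G)) X (s : tm G X^*) :
  eqv H (comp_snd (pfn_hat (enc s))) (below (len s)).
Proof.
  apply eqv_funext. change (wk (below (len s))) with (below (len (wk (C := TN) s))).
  rewrite below_app, <- snd_enc. apply beta2.
Qed.

Lemma dom_enc_below G (H : list (fm G)) X (s : tm G X^*) :
  eqv H (Cst (CDom (X ⊗ TB)) · enc s) (below (len s)).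
Proof.
  apply eqv_funext. change (wk (below (len s))) with (below (len (wk (C := TN) s))).
  rewrite below_app. apply dom_enc.
Qed.

(** [bnd u] serves only as a search bound: the search stops at the first
    undefined position, so [dec (enc s)] never requires [bnd (enc s) = |s|]. *)
Definition dec {G X} (u : tm G (X ⊗ TB)^†) : tm G X^* :=
  take (comp_fst (pfn_hat u)) (search (Cst (CDom (X ⊗ TB)) · u) (bnd u)).

Lemma dec_enc G (H : list (fm G)) X (s : tm G X^*) : eqv H (dec (enc s)) s.
Proof.
  unfold dec.
  rewrite comp_fst_enc, dom_enc_below, search_below, ite_false.
  - apply take_seq_hat.
  (* If the bound were below [len s] it would lie in the domain, and then [ax_bnd] would make it
     less than itself. *)
  - bcase (ltb (bnd (enc s)) (len s)) E; [|exact E].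
    rewrite <- dom_enc in E.
    assert (F : eqv H0 (monus (succ (bnd (enc s))) (bnd (enc s))) zeroN).
    { eapply p_impE; [apply p_ax; left; apply ax_bnd|exact E]. }
    apply true_neq_false. rewrite <- (ltb_irrefl H0 (bnd (enc s))).
    unfold ltb. now rewrite F, is_zero_zero.
Qed.

(** * Simulation of Spector's recursion *)

(** Only branches flagged [ttrue] are queried, so the recursion never leaves the codes of
    sequences. *)
Definition sphi {G X R} (phi : tm G (X^* ⇒ (X ⇒ R) ⇒ R))
  : tm G ((X ⊗ TB)^† ⇒ (X ⊗ TB ⇒ R) ⇒ R) :=
  Lam (Lam (Lam (v2 · dec v1 · Lam (v1 · tpair v0 ttrue)))) · phi.

Definition sb {G X R} (b : tm G (X^* ⇒ R)) : tm G ((X ⊗ TB)^† ⇒ R) :=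
  Lam (Lam (v1 · dec v0)) · b.

(** The control functional receives a total function and no domain, so it must locate the end of the
    sequence from the flags. *)
Definition spsi {G X} (f : tm G ((TN ⇒ X) ⇒ TN)) : tm G ((TN ⇒ X ⊗ TB) ⇒ TN) :=
  Lam (Lam (search (comp_snd v0) (v1 · comp_fst v0))) · f.

Definition Delta {G X R} : tm G (BR_ty X R) :=
  Lam (Lam (Lam (Lam
    (Cst (CsBR (X ⊗ TB) R) · sphi v3 · sb v2 · spsi v1 · enc v0)))).

Lemma Delta_app G (H : list (fm G)) X R (phi : tm G (X^* ⇒ (X ⇒ R) ⇒ R)) b f s :
  eqv H (Delta · phi · b · f · s)
    (Cst (CsBR (X ⊗ TB) R) · sphi phi · sb b · spsi f · enc s).
Proof. apply beta4. Qed.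

Lemma spsi_enc G (H : list (fm G)) X (f : tm G ((TN ⇒ X) ⇒ TN)) s :
  eqv H (spsi f · pfn_hat (enc s))
    (ite (ltb (f · seq_hat s) (len s)) (f · seq_hat s) (len s)).
Proof.
  transitivity (search (comp_snd (pfn_hat (enc s)))
    (f · comp_fst (pfn_hat (enc s)))).
  - apply beta2.
  - now rewrite comp_snd_enc, comp_fst_enc, search_below.
Qed.

Lemma Lt_ltb G (H : list (fm G)) (m n : tm G TN) :
  H ⊢ Lt m n -> eqv H (ltb m n) ttrue.
Proof.
  intros E. change (eqv H (monus (succ m) n) zeroN) in E.
  unfold ltb. now rewrite E, is_zero_zero.
Qed.

(** The boolean is decided; if it were true, [is_zero_true] would give back [Lt m n]. *)
Lemma not_Lt_ltb G (H : list (fm G)) (m n : tm G TN) :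
  H ⊢ Not (Lt m n) -> eqv H (ltb m n) tfalse.
Proof.
  intros E. apply (@bool_case _ _ _ (ltb m n)); [|apply eqv_hyp].
  apply p_botE. eapply p_impE.
  - eapply prv_weaken; [exact E|]. now right.
  - apply is_zero_true, eqv_hyp.
Qed.

(** [n] stands under an abstraction, out of reach of rewriting, so the branch is presented as a
    substitution instance in [n]. *)
Lemma eqv_ext_branch G (H : list (fm G)) Z R (r : tm G (Z^† ⇒ R)) u n m :
  eqv H n m ->
  eqv H (Lam (wk r · ext (wk u) (wk n) v0)) (Lam (wk r · ext (wk u) (wk m) v0)).
Proof.
  intros E.
  assert (S : forall p, subst (sub1 p) (Lam (wk (wk r) · ext (wk (wk u)) v1 v0))
                = Lam (wk r · ext (wk u) (wk p) v0)).
  { intros p. cbn. now rewrite !subst_up_wk, !subst_sub1_wk. }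
  rewrite <- !S. now apply eqv_subst.
Qed.

Lemma wk_ext_branch_app G (H : list (fm G)) Z R C (r : tm G (Z^† ⇒ R)) u n p :
  eqv (G := C :: G) (map fwk H) (wk (Lam (wk r · ext (wk u) (wk n) v0)) · p)
    (wk r · ext (wk u) (wk n) p).
Proof.
  unfold wk at 1. cbn. rewrite beta. cbn.
  now rewrite !rename_up_wk, !subst_sub1_wk.
Qed.

Lemma Delta_BR G (H : list (fm G)) X R (phi : tm G (X^* ⇒ (X ⇒ R) ⇒ R)) b f s :
  H ⊢ BR_eqn Delta phi b f s.
Proof.
  pose (rec := Cst (CsBR (X ⊗ TB) R) · sphi phi · sb b · spsi f).
  pose (n := spsi f · pfn_hat (enc s)).
  assert (S : forall H', H' ⊢ Cases (InDom n (enc s))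
    (Eq (rec · enc s) (sb b · enc s))
    (Eq (rec · enc s) (sphi phi · enc s ·
      Lam (wk rec · ext (wk (enc s)) (wk n) v0)))).
  { intros H'. apply p_ax. right. apply ax_sBR. }
  apply p_andI; apply p_impI.
  - assert (E := Lt_ltb (p_hyp _ (Lt (f · seq_hat s) (len s) :: H) _
      (or_introl eq_refl))).
    revert E. generalize (Lt (f · seq_hat s) (len s) :: H). intros K E.
    specialize (S K). apply p_andE1 in S.
    change (eqv K (Delta · phi · b · f · s) (b · s)).
    rewrite Delta_app. fold rec. transitivity (sb b · enc s).
    + eapply p_impE; [exact S|]. change (eqv K (dom (enc s) n) ttrue).
      (* The minimum is [f · seq_hat s], a position below [len s] and hence in the domain. *)
      unfold n. rewrite spsi_enc, ite_true by exact E. now rewrite dom_enc.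
    + transitivity (b · dec (enc s)); [apply beta2|]. now rewrite dec_enc.
  - assert (E := not_Lt_ltb (p_hyp _ (Not (Lt (f · seq_hat s) (len s)) :: H) _
      (or_introl eq_refl))).
    revert E. generalize (Not (Lt (f · seq_hat s) (len s)) :: H). intros K E.
    specialize (S K). apply p_andE2 in S.
    change (eqv K (Delta · phi · b · f · s)
      (phi · s · Lam (Delta · wk phi · wk b · wk f · snoc (wk s) v0))).
    (* Here the minimum is [len s], the first free position, so sBR extends the code exactly
       there. *)
    assert (N : eqv K n (len s)).
    { unfold n. now rewrite spsi_enc, ite_false. }
    rewrite Delta_app. fold rec.
    transitivity (sphi phi · enc s · Lam (wk rec · ext (wk (enc s)) (wk n) v0)).
    + eapply p_impE; [exact S|]. apply not_in_dom. now rewrite N, dom_enc_len.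
    + rewrite (eqv_ext_branch rec (enc s) N).
      set (g := Lam (wk rec · ext (wk (enc s)) (wk (len s)) v0)).
      transitivity (phi · dec (enc s) · Lam (wk g · tpair v0 ttrue));
        [apply beta3|].
      rewrite dec_enc. apply App_proper; [reflexivity|]. apply eqv_Lam.
      (* Writing [tpair v0 ttrue] at [len s] gives the code of [snoc s v0], so each branch is
         [Delta] at the extended sequence. *)
      unfold g. rewrite wk_ext_branch_app, Delta_app, enc_snoc. reflexivity.
Qed.

Theorem theorem5p1 (X R : ty) :
  exists Delta : tm nil (BR_ty X R),
    uses_only_sBR (X ⊗ TB) R Delta /\ EHA_sBR_proves (defines_BR Delta).
Proof.
  exists Delta. split.
  - cbn. repeat split.
  (* [Delta] contains no [canon], so [closed Delta] computes to [Delta] in the extended context. *)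
  - repeat apply p_allI. apply (Delta_BR []).
Qed.
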